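(* Let $n\ge 1$ and $d\ge 1$ be integers and let $g\in\mathbb{R}[x_1,\ldots,x_n]$ be a homogeneous polynomial of degree $d$, written $g(\mathbf{x})=\sum_{\alpha\in\mathbb{N}^n_d} g_\alpha\,\mathbf{x}^\alpha$ with coefficient vector $\mathbf{g}=(g_\alpha)_{\alpha\in\mathbb{N}^n_d}$, such that the sublevel set $G=\{\mathbf{x}\in\mathbb{R}^n : g(\mathbf{x})\le 1\}$ is compact. For $\alpha\in\mathbb{N}^n$ with $|\alpha|=d$ or $|\alpha|=2d$, let $\lambda_\alpha=\int_G \mathbf{x}^\alpha\,d\mathbf{x}$ be the moments of the Lebesgue measure on $G$. Let $\mathbf{M}_d(\lambda)$ be the real square matrix with rows and columns indexed by $\mathbb{N}^n_d$ and entries $\mathbf{M}_d(\lambda)[\alpha,\beta]=\lambda_{\alpha+\beta}$ for $\alpha,\beta\in\mathbb{N}^n_d$, and let $\lambda^{(d)}=(\lambda_\alpha)_{\alpha\in\mathbb{N}^n_d}$ be the vector of all moments of order $d$. Then $\mathbf{M}_d(\lambda)$ is nonsingular and $$\mathbf{g}=\frac{n+d}{n+2d}\;\mathbf{M}_d(\lambda)^{-1}\,\lambda^{(d)}.$$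
   Context: $\mathbb{N}$ denotes the nonnegative integers. For $\alpha=(\alpha_1,\ldots,\alpha_n)\in\mathbb{N}^n$, $|\alpha|=\sum_i\alpha_i$ and $\mathbf{x}^\alpha=x_1^{\alpha_1}\cdots x_n^{\alpha_n}$. $\mathbb{N}^n_d=\{\alpha\in\mathbb{N}^n : |\alpha|=d\}$. A polynomial $g$ is homogeneous of degree $d$ if $g(\lambda\mathbf{x})=\lambda^d g(\mathbf{x})$ for all $\lambda\in\mathbb{R}$ and all $\mathbf{x}\in\mathbb{R}^n$. Integrals are with respect to Lebesgue measure on $\mathbb{R}^n$. *)

(* Defs.v *)
From HB Require Import structures.
From mathcomp Require Import all_boot all_order all_algebra.
(* Both the notations and some names of mpoly clash with mathcomp-analysis. *)
From mathcomp Require Import -(notations) mpoly.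
From mathcomp Require Import all_classical all_reals all_analysis.

Import Order.TTheory GRing.Theory Num.Theory.
Import numFieldNormedType.Exports.

Set Implicit Arguments.
Unset Strict Implicit.
Unset Printing Implicit Defensive.

Local Open Scope classical_set_scope.
Local Open Scope ring_scope.

(* R^n is 'rV[R]_n: it carries the library's product topology, and is given
   here the product sigma-algebra (the coordinatewise Borel sets), following
   the library's construction for n.-tuple T. *)

Definition measure_rV_display : measure_display -> measure_display.
Proof. exact. Qed.

Section measurable_rV.
Context {d} {T : sigmaRingType d} (n : nat).

Let coors : 'I_n -> 'rV[T]_n -> T := fun i x => x ord0 i.

Let rV_set0 : g_sigma_preimage coors set0.
Proof. exact: sigma_algebra0. Qed.

Let rV_setC A : g_sigma_preimage coors A -> g_sigma_preimage coors (~` A).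
Proof. exact: sigma_algebraC. Qed.

Let rV_bigcup (F : _^nat) : (forall i, g_sigma_preimage coors (F i)) ->
  g_sigma_preimage coors (\bigcup_i (F i)).
Proof. exact: sigma_algebra_bigcup. Qed.

HB.instance Definition _ := @isMeasurable.Build (measure_rV_display d)
  'rV[T]_n (g_sigma_preimage coors) rV_set0 rV_setC rV_bigcup.

End measurable_rV.

Lemma measurable_coord d (T : sigmaRingType d) n (i : 'I_n) :
  measurable_fun [set: 'rV[T]_n] (fun x => x ord0 i).
Proof.
move=> _ Y mY; rewrite setTI; apply: sub_sigma_algebra => /=.
rewrite -bigcup_seq/=; exists i => /=; first by rewrite mem_index_enum.
by exists Y => //; rewrite setTI.
Qed.

Lemma measurable_fun_rV d1 d2 (T1 : measurableType d1) (T2 : measurableType d2)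
    n (f : T1 -> 'rV[T2]_n) :
  (forall i, measurable_fun [set: T1] (fun x => f x ord0 i)) ->
  measurable_fun [set: T1] f.
Proof.
move=> mf.
have : g_sigma_preimage (fun i => (fun x : 'rV[T2]_n => x ord0 i) \o f)
    `<=` measurable.
  apply: smallest_sub; first exact: sigma_algebra_measurable.
  case: n => [|n] in f mf *; first by rewrite big_ord0.
  rewrite -bigcup_mkord_ord; apply: bigcup_sub => i Ii.
  by move=> A [B mB <-]; exact: mf.
by rewrite g_sigma_preimage_comp => prefS _ A mA; apply: prefS; exists A.
Qed.

Section lebesgue_cons.
Context {R : realType} (n : nat).

Definition rV_cons (p : measurableTypeR R * 'rV[R]_n) : 'rV[R]_n.+1 :=
  row_mx (const_mx p.1 : 'rV[R]_1) p.2.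

Let rV_uncons (x : 'rV[R]_n.+1) : measurableTypeR R * 'rV[R]_n :=
  (x ord0 ord0, \row_i x ord0 (lift ord0 i)).

Lemma rV_cons0 p : rV_cons p ord0 ord0 = p.1.
Proof.
by rewrite /rV_cons mxE; case: splitP => // j _; rewrite mxE.
Qed.

Lemma rV_consS p i : rV_cons p ord0 (lift ord0 i) = p.2 ord0 i.
Proof.
rewrite /rV_cons mxE; case: splitP => [[[]]//|k /= eik].
by congr (p.2 _ _); apply/val_inj; move: eik => /= [].
Qed.

Let rV_consK : cancel rV_cons rV_uncons.
Proof.
move=> [x v]; rewrite /rV_uncons rV_cons0; congr pair.
by apply/rowP => i; rewrite mxE rV_consS.
Qed.

Lemma measurable_rV_cons : measurable_fun [set: _] rV_cons.
Proof.
apply: measurable_fun_rV => i.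
have [j ->|->] := unliftP ord0 i.
  rewrite (_ : (fun x => _) = (fun x : 'rV[R]_n => x ord0 j) \o snd).
    exact: (measurableT_comp (measurable_coord j) measurable_snd).
  by apply/funext => p /=; rewrite rV_consS.
rewrite (_ : (fun x => _) = fst); first exact: measurable_fst.
by apply/funext => p /=; rewrite rV_cons0.
Qed.

Let measurable_rV_uncons : measurable_fun [set: _] rV_uncons.
Proof.
apply/measurable_fun_pairP; split; first exact: (measurable_coord ord0).
apply: measurable_fun_rV => i.
rewrite (_ : (fun x => _) = (fun x : 'rV[R]_n.+1 => x ord0 (lift ord0 i))).
  exact: measurable_coord.
by apply/funext => x; rewrite /= mxE.
Qed.

Variable mu : {sigma_finite_measure set 'rV[R]_n -> \bar R}.

Definition lebesgue_cons : set 'rV[R]_n.+1 -> \bar R :=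
  pushforward (@lebesgue_measure R \x mu)%E rV_cons.

Let mpre A : measurable A -> measurable (rV_cons @^-1` A).
Proof. by move=> mA; rewrite -[X in measurable X]setTI; exact: measurable_rV_cons. Qed.

Let lebesgue_cons0 : lebesgue_cons set0 = 0%E.
Proof. by rewrite /lebesgue_cons /pushforward preimage_set0 measure0. Qed.

Let lebesgue_cons_ge0 A : (0 <= lebesgue_cons A)%E.
Proof. by rewrite /lebesgue_cons /pushforward; exact: measure_ge0. Qed.

Let lebesgue_cons_sigma_additive : semi_sigma_additive lebesgue_cons.
Proof.
move=> F mF tF mUF; rewrite /lebesgue_cons /pushforward preimage_bigcup.
apply: measure_semi_sigma_additive.
- by move=> k; exact: mpre.
- apply/trivIsetP => /= i j _ _ ij; rewrite -preimage_setI.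
  by move/trivIsetP : tF => /(_ _ _ _ _ ij) ->//; rewrite preimage_set0.
- by rewrite -preimage_bigcup; exact: mpre.
Qed.

HB.instance Definition _ := isMeasure.Build _ _ _ lebesgue_cons
  lebesgue_cons0 lebesgue_cons_ge0 lebesgue_cons_sigma_additive.

Let lebesgue_cons_sigma_finite : sigma_finite setT lebesgue_cons.
Proof.
have [H UH mH] : sigma_finite setT (@lebesgue_measure R \x mu)%E.
  have /sigma_finiteP[F [TF ndF Foo]] := sigma_finiteT (@lebesgue_measure R).
  have /sigma_finiteP[G [TG ndG Goo]] := sigma_finiteT mu.
  exists (fun k => F k `*` G k).
    rewrite -setXTT TF TG predeqE => -[x y]; split.
      move=> [/= [k _ Fkx] [l _ Gly]]; exists (maxn k l) => //; split.
      - by move: x Fkx; exact/subsetPset/ndF/leq_maxl.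
      - by move: y Gly; exact/subsetPset/ndG/leq_maxr.
    by move=> [k _ []/= ? ?]; split; exists k.
  move=> k; have [? ?] := Foo k; have [? ?] := Goo k.
  split; first exact: measurableX.
  by rewrite product_measure1E// lte_mul_pinfty// ge0_fin_numE.
exists (fun k => rV_uncons @^-1` H k).
  by rewrite -preimage_bigcup -UH preimage_setT.
move=> k; split.
  by rewrite -[X in measurable X]setTI; apply: measurable_rV_uncons => //;
    exact: (mH k).1.
rewrite /lebesgue_cons /pushforward -comp_preimage.
rewrite (_ : rV_uncons \o rV_cons = id); last exact/funext/rV_consK.
by rewrite preimage_id; exact: (mH k).2.
Qed.

HB.instance Definition _ := Measure_isSigmaFinite.Build _ _ _ lebesgue_cons
  lebesgue_cons_sigma_finite.

End lebesgue_cons.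

Section lebesgue_rV.
Context {R : realType}.

(* Lebesgue measure on the Borel sets of R^n: the n-fold product of the
   one-dimensional Lebesgue measure (the unit mass for n = 0). *)
Fixpoint lebesgue_rV (n : nat) : {sigma_finite_measure set 'rV[R]_n -> \bar R} :=
  match n with
  | 0 => dirac (0 : 'rV[R]_0)
  | m.+1 => lebesgue_cons (lebesgue_rV m)
  end.

Lemma lebesgue_rV_prod n (A : 'I_n -> set R) : (forall i, measurable (A i)) ->
  lebesgue_rV n [set x | forall i, A i (x ord0 i)] =
  (\prod_(i < n) @lebesgue_measure R (A i))%E.
Proof.
elim: n A => [|n IH] A mA.
  rewrite big_ord0 /= diracE mem_set//=; by case.
have mS : measurable [set v : 'rV[R]_n | forall i, A (lift ord0 i) (v ord0 i)].
  rewrite (_ : [set _ | _] = \bigcap_(i in [set: 'I_n])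
      ((fun x : 'rV[R]_n => x ord0 i) @^-1` A (lift ord0 i))).
    apply: fin_bigcap_measurable => // i _.
    by rewrite -[X in measurable X]setTI; apply: measurable_coord.
  by apply/seteqP; split=> [x H i _|x H i]; exact: H.
rewrite big_ord_recl -IH//.
rewrite /= /lebesgue_cons /pushforward -product_measure1E//; last exact: mA.
congr (product_measure1 _ _ _); apply/seteqP; split=> [[x v]/= H|[x v]/= [H0 H] i].
  by split=> [|i]; [have := H ord0; rewrite rV_cons0|
    have := H (lift ord0 i); rewrite rV_consS].
by have [j ->|->] := unliftP ord0 i; rewrite ?rV_cons0 ?rV_consS.
Qed.

End lebesgue_rV.

Section moments.
Context {R : realType} (n : nat).
Implicit Types (d : nat) (g : mpoly n R) (G : set 'rV[R]_n).

Definition homogeneous d g : Prop :=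
  forall (t : R) (x : 'rV[R]_n),
    meval ((t *: x) ord0) g = t ^+ d * meval (x ord0) g.

Definition sublevel1 g : set 'rV[R]_n := [set x | meval (x ord0) g <= 1].

Definition moment G (alpha : multinom n) : R :=
  \int[lebesgue_rV n]_(x in G) \prod_(i < n) x ord0 i ^+ alpha i.

(* The exponents alpha in N^n with |alpha| = d. *)
Definition exponents d : finType :=
  {m : bmultinom n d.+1 | mdeg m == d}.

(* Vectors and matrices indexed by [exponents d] go through the library's
   enumeration of that finite type. *)
Definition exponent d (i : 'I_#|exponents d|) : multinom n :=
  val (val (enum_val i)).

Definition moment_mx d (lambda : multinom n -> R) : 'M[R]_#|exponents d| :=
  \matrix_(i, j) lambda (mnm_add (exponent i) (exponent j)).

Definition moment_vec d (lambda : multinom n -> R) : 'cV[R]_#|exponents d| :=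
  \col_i lambda (exponent i).

Definition coef_vec d g : 'cV[R]_#|exponents d| :=
  \col_i mcoeff (exponent i) g.

End moments.

(* Main.v *)
Require Import Defs.
From HB Require Import structures.
From mathcomp Require Import all_boot all_order all_algebra.
From mathcomp Require Import -(notations) mpoly.
From mathcomp Require Import all_classical all_reals all_analysis.
From mathcomp Require Import measurable_realfun ring.

Import Order.TTheory GRing.Theory Num.Theory.
Import numFieldNormedType.Exports.

Set Implicit Arguments.
Unset Strict Implicit.
Unset Printing Implicit Defensive.

Local Open Scope classical_set_scope.
Local Open Scope ring_scope.

(** Write G for the sublevel set of g at level 1 and c_i for the coefficients
of g.  The i-th entry of M *m g is the integral over G of x^(alpha_i) times
the sum of the c_j x^(alpha_j), that is, of x^(alpha_i) g(x).  So the theorem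
amounts to two facts: M is invertible, and for p homogeneous of degree d

  (n + 2 d) * int_G p g = (n + d) * int_G p.

The second fact ([moment_homogeneous], for p of any degree m) is Euler's
identity in integral form, and it follows from scaling alone.  For 0 < r < 1
the set r G is the sublevel set of g at level r^d, and since Lebesgue measure
scales by r^n ([lebesgue_rV_scale]), int_(rG) f = r^(n + m) int_G f whenever
f is homogeneous of degree m.  Subtracting from the integral over G gives, on
the shell S = G \ rG,

  int_S p g = (1 - r^(n + m + d)) int_G p g,
  int_S p   = (1 - r^(n + m)) int_G p.

On S the values of g lie between r^d and 1, so the two left-hand sides differ
by at most (1 - r^d) int_S |p|, which is of second order in 1 - r
([sublevel_shell_estimate]).  Dividing by 1 - r and letting r tend to 1
([squeeze_at1]) yields the identity.

For the first fact, u^T M u is the integral over G of h^2, where h is the sum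
of the u_i x^(alpha_i).  If it vanishes then so does h: a point where h is
nonzero can be shrunk towards 0 until g < 1 there, and h^2 is then bounded
below on a small box inside G ([square_integral_eq0]).  A form that vanishes
identically has zero coefficients ([exponent_poly_eq0]).  *)

(** * Scaling of Lebesgue measure *)

Lemma measurable_mulr (R : realType) (r : R) :
  measurable_fun setT (fun x : measurableTypeR R => r * x : measurableTypeR R).
Proof. exact: mulrl_measurable. Qed.

Lemma measurable_scale_rV (R : realType) n (r : R) :
  measurable_fun setT (fun x : 'rV[R]_n => r *: x : 'rV[R]_n).
Proof.
apply: measurable_fun_rV => i; under eq_fun do rewrite mxE.
by apply: (measurableT_comp (measurable_mulr r)); exact: measurable_coord.
Qed.

(** Half-open intervals determine Lebesgue measure, so it is enough to compare
it on them with r times its image under the scaling by r. *)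
Lemma lebesgue_measure_scale (R : realType) (r : R) (A : set R) :
  0 < r -> measurable A ->
  lebesgue_measure ((fun x => r * x) @^-1` A) =
  (r^-1%:E * lebesgue_measure A)%E.
Proof.
move=> r0 mA.
pose k : {nonneg R} := NngNum (ltW r0).
(* nu is a measure because the map is measurable: that proof is its argument. *)
pose nu : {measure set (measurableTypeR R) -> \bar R} :=
  mscale k (@pushforward _ _ (measurableTypeR R) (measurableTypeR R) R
    (@lebesgue_measure R) (fun x => r * x)).
have nuE B : measurable B -> lebesgue_measure B = nu (@measurable_mulr R r) B.
  move: B; apply: lebesgue_measure_unique => _ [[a b] _ <-].
  rewrite [RHS]/= /mscale /= /pushforward.
  have -> : (fun x => r * x) @^-1` `]a, b]%classic =
      `](r^-1 * a), (r^-1 * b)]%classic.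
    apply/seteqP; split => x /=;
      by rewrite !in_itv /= ltr_pdivrMl // ler_pdivlMl.
  rewrite !lebesgue_measure_itv /= !lte_fin ltr_pM2l ?invr_gt0//.
  case: ifP => _; rewrite ?mule0 // -!EFinB -EFinM; congr EFin.
  by field; rewrite gt_eqF.
rewrite [X in (_ * X)%E]nuE//= /mscale /= muleA -EFinM mulVf ?mul1e//.
by rewrite gt_eqF.
Qed.

(** Induction on the dimension: a product measure is determined by its values
on rectangles, where the factor r * r^n comes from the two sides. *)
Lemma lebesgue_rV_scale (R : realType) n (r : R) (A : set 'rV[R]_n) :
  0 < r -> measurable A ->
  lebesgue_rV n ((fun x => r *: x) @^-1` A) =
  ((r^-1 ^+ n)%:E * lebesgue_rV n A)%E.
Proof.
move=> r0; elim: n A => [|n IH] A mA.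
  rewrite expr0 mul1e; congr (lebesgue_rV 0 _).
  by apply/seteqP; split => x /=; rewrite !(flatmx0, thinmx0).
pose k : {nonneg R} := NngNum (ltW (exprn_gt0 n.+1 r0)).
pose phi (p : measurableTypeR R * 'rV[R]_n) : measurableTypeR R * 'rV[R]_n :=
  (r * p.1, r *: p.2).
have mphi : measurable_fun setT phi.
  apply/measurable_fun_pairP; split.
    by apply: (measurableT_comp (measurable_mulr r)); exact: measurable_fst.
  apply: (measurableT_comp (@measurable_scale_rV R n r)).
  exact: measurable_snd.
pose nu : {measure set (measurableTypeR R * 'rV[R]_n) -> \bar R} :=
  mscale k (pushforward (@lebesgue_measure R \x lebesgue_rV n)%E phi).
have nuE : forall B, measurable B ->
    (@lebesgue_measure R \x lebesgue_rV n)%E B = nu mphi B.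
  have := @product_measure_unique _ _ _ _ _
    (@lebesgue_measure R) (lebesgue_rV n) (nu mphi).
  apply => B C mB mC.
  rewrite /= /mscale /= /pushforward.
  have -> : phi @^-1` (B `*` C) =
    ((fun x => r * x) @^-1` B) `*` ((fun x => r *: x) @^-1` C) by [].
  rewrite product_measure1E; first last.
  - by rewrite -[X in measurable X]setTI; exact: measurable_scale_rV.
  - by rewrite -[X in measurable X]setTI; exact: measurable_mulr.
  rewrite [X in (_ * (X * _))%E](lebesgue_measure_scale r0 mB) IH //.
  have E : ((r ^+ n.+1)%:E * (r^-1%:E * (r^-1 ^+ n)%:E) = 1)%E.
    by rewrite -!EFinM -exprS exprVn mulfV// gt_eqF// exprn_gt0.
  by rewrite muleACA [LHS]muleA E mul1e.
rewrite /= /lebesgue_cons /pushforward.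
have mA' : measurable (@rV_cons R n @^-1` A).
  by rewrite -[X in measurable X]setTI; exact: (@measurable_rV_cons R n).
rewrite [X in (_ * X)%E]nuE //= /mscale /= muleA -EFinM exprVn.
rewrite mulVf ?mul1e ?gt_eqF ?exprn_gt0//.
rewrite /pushforward; congr (product_measure1 _ _ _).
have consZ p : @rV_cons R n (phi p) = r *: @rV_cons R n p.
  apply/rowP => i; rewrite [RHS]mxE.
  by have [j ->|->] := unliftP ord0 i; rewrite ?rV_cons0 ?rV_consS ?[LHS]mxE.
by apply/seteqP; split => p /=; rewrite consZ.
Qed.

Lemma ge0_integral_scale (R : realType) n (r : R) (D : set 'rV[R]_n)
    (f : 'rV[R]_n -> \bar R) :
  0 < r -> measurable D -> measurable_fun setT f ->
  (forall x, 0 <= f x)%E ->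
  (\int[lebesgue_rV n]_(x in (fun x => r *: x) @^-1` D) f (r *: x) =
  (r^-1 ^+ n)%:E * \int[lebesgue_rV n]_(x in D) f x)%E.
Proof.
move=> r0 mD mf f0.
have c0 : 0 <= r^-1 ^+ n by rewrite exprn_ge0// invr_ge0 ltW.
have mfD : measurable_fun D f by exact: measurable_funTS.
rewrite -[X in (X * _)%E]/((NngNum c0)%:num%:E) -ge0_integral_mscale//.
rewrite -(ge0_integral_pushforward (@measurable_scale_rV R n r))//.
apply: eq_measure_integral => [|? A mA _]; first exact: measurable_scale_rV.
exact: lebesgue_rV_scale.
Qed.

Lemma Rintegral_scale (R : realType) n (r : R) (D : set 'rV[R]_n)
    (f : 'rV[R]_n -> R) :
  0 < r -> measurable D -> measurable_fun setT f ->
  (lebesgue_rV n).-integrable D (EFin \o f) ->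
  \int[lebesgue_rV n]_(x in (fun x => r *: x) @^-1` D) f (r *: x) =
  r^-1 ^+ n * \int[lebesgue_rV n]_(x in D) f x.
Proof.
move=> r0 mD mf intf.
have mEf : measurable_fun setT (EFin \o f) by exact/measurable_EFinP.
rewrite /Rintegral integralE [in RHS]integralE.
have Ip := @integrable_pos_fin_num _ _ _ _ _ mD _ intf.
have In := @integrable_neg_fin_num _ _ _ _ _ mD _ intf.
have mp := measurable_funepos mEf; have mn := measurable_funeneg mEf.
have Ep := ge0_integral_scale r0 mD mp (funepos_ge0 _).
have En := ge0_integral_scale r0 mD mn (funeneg_ge0 _).
have {}Ep : (\int[lebesgue_rV n]_(x in (fun x => r *: x) @^-1` D)
    ((fun x => (f (r *: x))%:E)^\+ x) =
    (r^-1 ^+ n)%:E * \int[lebesgue_rV n]_(x in D) (EFin \o f)^\+ x)%E.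
  by rewrite -Ep; apply: eq_integral => x _; rewrite !funeposE.
have {}En : (\int[lebesgue_rV n]_(x in (fun x => r *: x) @^-1` D)
    ((fun x => (f (r *: x))%:E)^\- x) =
    (r^-1 ^+ n)%:E * \int[lebesgue_rV n]_(x in D) (EFin \o f)^\- x)%E.
  by rewrite -En; apply: eq_integral => x _; rewrite !funenegE.
by rewrite Ep En -(fineK Ip) -(fineK In) -!EFinM -!EFinB /= mulrBr.
Qed.

(** * Polynomial functions on compact sets *)

Lemma continuous_meval (R : realType) n (p : mpoly n R) :
  continuous (fun x : 'rV[R]_n => meval (x ord0) p).
Proof.
rewrite (_ : (fun _ => _) = fun x : 'rV[R]_n =>
    \sum_(m <- msupp p) mcoeff m p * \prod_i x ord0 i ^+ m i); last first.
  by apply/funext => x; rewrite mevalE.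
apply: (@continuous_big R _ +%R 0 xpredT) => [|m _].
  by move=> x; apply: cvgD; [exact: cvg_fst|exact: cvg_snd].
move=> x; apply: continuousM; first exact: cst_continuous.
move: x; apply: (@continuous_big R _ *%R 1 xpredT) => [|i _ x].
  by move=> x; apply: cvgM; [exact: cvg_fst|exact: cvg_snd].
apply: (@continuous_comp _ _ _ (fun x : 'rV[R]_n => x ord0 i)
  (fun y => y ^+ m i)).
  exact: coord_continuous.
exact: exprn_continuous.
Qed.

Lemma measurable_meval (R : realType) n (p : mpoly n R) :
  measurable_fun setT (fun x : 'rV[R]_n => meval (x ord0) p).
Proof.
under eq_fun do rewrite mevalE.
apply: measurable_sum => m; apply: measurable_funM => //.
apply: measurable_prod => i _.
by apply: measurable_funX; exact: measurable_coord.
Qed.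

Lemma measurable_sublevel (R : realType) n (p : mpoly n R) c :
  measurable [set x : 'rV[R]_n | meval (x ord0) p <= c].
Proof.
rewrite -[X in measurable X]setTI.
rewrite (_ : [set x | _] =
    (fun x : 'rV[R]_n => meval (x ord0) p) @^-1` [set` `]-oo, c]]).
  exact: measurable_meval.
by apply/seteqP; split => x /=; rewrite in_itv.
Qed.

Lemma measurable_box (R : realType) n (A : 'I_n -> set R) :
  (forall i, measurable (A i)) ->
  measurable [set x : 'rV[R]_n | forall i, A i (x ord0 i)].
Proof.
move=> mA.
rewrite (_ : [set _ | _] = \bigcap_(i in [set: 'I_n])
    ((fun x : 'rV[R]_n => x ord0 i) @^-1` A i)).
  apply: fin_bigcap_measurable => // i _.
  by rewrite -[X in measurable X]setTI; apply: measurable_coord.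
by apply/seteqP; split=> [x H i _|x H i]; exact: H.
Qed.

Lemma lebesgue_rV_compact (R : realType) n (G : set 'rV[R]_n) :
  compact G -> measurable G -> (lebesgue_rV n G < +oo)%E.
Proof.
move=> /compact_bounded[M [_ MG]] mG.
pose e := `|M| + 1.
have Ge x : G x -> `|x| <= e.
  by apply: MG; rewrite (le_lt_trans (ler_norm M))// ltrDl.
pose A (i : 'I_n) := [set` `[- e, e]%R] : set R.
have mA i : measurable (A i) by exact: measurable_itv.
have mB := measurable_box mA.
apply: (@le_lt_trans _ _
    (lebesgue_rV n [set x : 'rV[R]_n | forall i, A i (x ord0 i)])).
  apply: le_measure; rewrite ?inE// => x Gx i.
  rewrite /A /= in_itv /= -ler_norml.
  apply: le_trans (Ge _ Gx).
  rewrite [leRHS]/Num.norm /= mx_normrE.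
  exact: (@le_bigmax _ R _ 0 (fun j : 'I_1 * 'I_n => `|x j.1 j.2|) (ord0, i)).
rewrite lebesgue_rV_prod//.
suff : (\prod_(i < n) lebesgue_measure (A i))%E \is a fin_num.
  by rewrite fin_numElt => /andP[].
elim/big_ind : _ => // [x y xf yf|i _]; first by rewrite fin_numM.
by rewrite /A lebesgue_measure_itv /=; case: ifP.
Qed.

Lemma meval_integrable (R : realType) n (G : set 'rV[R]_n) (p : mpoly n R) :
  compact G -> measurable G ->
  (lebesgue_rV n).-integrable G
    (EFin \o (fun x : 'rV[R]_n => meval (x ord0) p)).
Proof.
move=> cG mG; apply: measurable_bounded_integrable => //.
- exact: lebesgue_rV_compact.
- by apply: measurable_funTS; exact: measurable_meval.
have /compact_bounded[M [Mr HM]] :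
    compact ((fun x : 'rV[R]_n => meval (x ord0) p) @` G).
  apply: continuous_compact => //; apply: continuous_subspaceT.
  exact: continuous_meval.
by exists M; split => // y My x Gx; apply: (HM y My); exists x.
Qed.

(** * Integrating a form against g *)

Lemma homogeneousE (R : realType) n k (p : mpoly n R) (r : R) (x : 'rV[R]_n) :
  homogeneous k p -> meval ((r *: x) ord0) p = r ^+ k * meval (x ord0) p.
Proof. exact. Qed.

Section shell.
Context (R : realType) (n d : nat) (g : mpoly n R).
Context (g_homog : homogeneous d g) (G_compact : compact (sublevel1 g)).

Let mu := lebesgue_rV n : {sigma_finite_measure set 'rV[R]_n -> \bar R}.

(** By homogeneity, for r > 0 this is the dilation by r of the set G. *)
Let Gr (r : R) := [set x : 'rV[R]_n | meval (x ord0) g <= r ^+ d].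

Let Gr_sub r : 0 < r -> r <= 1 -> Gr r `<=` sublevel1 g.
Proof.
by move=> r0 r1 x /= /le_trans; apply; rewrite exprn_ile1// ltW.
Qed.

Let mGr r : measurable (Gr r).
Proof. exact: measurable_sublevel. Qed.

Let mG : measurable (sublevel1 g).
Proof. exact: measurable_sublevel. Qed.

Let integrableG p :
  mu.-integrable (sublevel1 g) (EFin \o (fun x : 'rV[R]_n => meval (x ord0) p)).
Proof. exact: meval_integrable. Qed.

(** Stated for functions rather than polynomials, so as to cover |p| too. *)
Lemma Rintegral_sublevel_scale m (f : 'rV[R]_n -> R) r :
  (forall x : 'rV[R]_n, f (r *: x) = r ^+ m * f x) -> measurable_fun setT f ->
  mu.-integrable (sublevel1 g) (EFin \o f) -> 0 < r -> r <= 1 ->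
  \int[mu]_(x in Gr r) f x = r ^+ (n + m) * \int[mu]_(x in sublevel1 g) f x.
Proof.
move=> f_homog mf intf r0 r1.
have rn0 : r ^+ n != 0 by rewrite expf_neq0// gt_eqF.
have intr : mu.-integrable (Gr r) (EFin \o f).
  by apply: integrableS intf => //; exact: Gr_sub.
have := Rintegral_scale r0 (mGr r) mf intr.
have -> : (fun x : 'rV[R]_n => r *: x) @^-1` Gr r = sublevel1 g.
  apply/seteqP; split => x;
    rewrite /Gr /sublevel1 /= (homogeneousE _ _ g_homog).
    by rewrite -ler_pdivlMl ?exprn_gt0// mulVf// expf_neq0// gt_eqF.
  by move=> gx; rewrite ger_pMr// exprn_gt0.
under eq_Rintegral do rewrite f_homog.
rewrite RintegralZl// exprVn => /(congr1 (fun z => r ^+ n * z)).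
by rewrite mulVKf// mulrA -exprD.
Qed.

(** The quantity under the absolute value is the integral of p * g - p over
the shell G \ Gr r, where 0 <= 1 - g < 1 - r^d. *)
Lemma sublevel_shell_estimate m p r :
  homogeneous m p -> 0 < r -> r <= 1 ->
  `|(1 - r ^+ (n + m + d)) *
      \int[mu]_(x in sublevel1 g) (meval (x ord0) (p * g))
    - (1 - r ^+ (n + m)) * \int[mu]_(x in sublevel1 g) (meval (x ord0) p)|
  <= (1 - r ^+ d) * (1 - r ^+ (n + m)) *
     \int[mu]_(x in sublevel1 g) `|meval (x ord0) p|.
Proof.
move=> p_homog r0 r1.
have shell m' (f : 'rV[R]_n -> R) :
    (forall x : 'rV[R]_n, f (r *: x) = r ^+ m' * f x) ->
    measurable_fun setT f -> mu.-integrable (sublevel1 g) (EFin \o f) ->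
  \int[mu]_(x in sublevel1 g `\` Gr r) f x =
  (1 - r ^+ (n + m')) * \int[mu]_(x in sublevel1 g) f x.
  move=> fh mf intf.
  rewrite mulrBl mul1r -(Rintegral_sublevel_scale fh)//.
  rewrite -[in X in _ = X - _](setDUK (Gr_sub r0 r1)) Rintegral_setU//.
  - by rewrite addrAC subrr add0r.
  - exact: measurableD.
  - by rewrite setDUK//; exact: Gr_sub.
  - by apply/disj_set2P; rewrite setDIK.
have mS : measurable (sublevel1 g `\` Gr r) by exact: measurableD.
have intS f : mu.-integrable (sublevel1 g) (EFin \o f) ->
    mu.-integrable (sublevel1 g `\` Gr r) (EFin \o f).
  by apply: integrableS => // x [].
have pg_homog (x : 'rV[R]_n) :
    meval ((r *: x) ord0) (p * g) = r ^+ (m + d) * meval (x ord0) (p * g).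
  rewrite !mevalM (homogeneousE _ _ p_homog) (homogeneousE _ _ g_homog).
  by rewrite exprD mulrACA.
rewrite -addnA.
rewrite -(shell _ (fun x : 'rV[R]_n => meval (x ord0) (p * g)) pg_homog)//;
  last exact: measurable_meval.
rewrite -(shell m (fun x : 'rV[R]_n => meval (x ord0) p))//;
  last exact: measurable_meval.
have intn : mu.-integrable (sublevel1 g)
    (EFin \o (fun x : 'rV[R]_n => `|meval (x ord0) p|)).
  exact: (integrable_norm (integrableG p)).
rewrite -mulrA -(shell m (fun x : 'rV[R]_n => `|meval (x ord0) p|))//;
  last 2 first.
- move=> x; rewrite (homogeneousE _ _ p_homog) normrM ger0_norm//.
  by rewrite exprn_ge0// ltW.
- by apply: measurableT_comp => //; exact: measurable_meval.
rewrite -RintegralB//; [|exact: intS..].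
rewrite -RintegralZl//; last exact: intS.
have intB : mu.-integrable (sublevel1 g `\` Gr r)
    (EFin \o (fun x : 'rV[R]_n => meval (x ord0) (p * g) - meval (x ord0) p)).
  apply: intS; rewrite (_ : (fun x : 'rV[R]_n => _) =
    (fun x : 'rV[R]_n => meval (x ord0) (p * g - p))) //.
  by apply/funext => x; rewrite mevalB.
apply: le_trans (le_normr_Rintegral mS intB) _.
apply: le_Rintegral => //.
- exact: (integrable_norm intB).
- by apply: intS; exact: (integrableZl mG (1 - r ^+ d) intn).
move=> x [/= gx1 /negP]; rewrite -ltNge => rgx.
rewrite mevalM -[X in _ - X]mulr1 -mulrBr normrM mulrC ler_wpM2r//.
by rewrite ler0_norm ?subr_le0// opprB lerD2l lerN2 ltW.
Qed.

End shell.

(** Both sides are divisible by 1 - r, and the right one even by its square.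
After one division only polynomials in r remain, so that r = 1 is reached by
continuity; there each quotient (1 - r^k) / (1 - r) takes the value k. *)
Lemma squeeze_at1 (R : realType) (a b e : nat) (I L N : R) :
  (forall r, 0 < r -> r < 1 ->
    `|(1 - r ^+ a) * I - (1 - r ^+ b) * L| <=
    (1 - r ^+ e) * (1 - r ^+ b) * N) ->
  a%:R * I = b%:R * L.
Proof.
move=> H.
pose S k : {poly R} := \sum_(i < k) 'X^i.
have SE k r : 1 - r ^+ k = (1 - r) * (S k).[r].
  rewrite -[LHS]opprB subrX1 -mulNr opprB horner_sum.
  by under [in RHS]eq_bigr do rewrite hornerXn.
have S1 k : (S k).[1] = k%:R.
  rewrite horner_sum; under eq_bigr do rewrite hornerXn expr1n.
  by rewrite sumr_const card_ord.
pose P := I *: S a - L *: S b.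
pose Q := N *: ((1 - 'X^e) * S b).
suff : `|P.[1]| - Q.[1] <= 0.
  rewrite !hornerE /= ?hornerXn !S1 expr1n subrr mulr0 mul0r subr0.
  by rewrite normr_le0 subr_eq0 mulrC [L * _]mulrC => /eqP.
have cF : `|P.[r]| - Q.[r] @[r --> 1^'-] --> `|P.[1]| - Q.[1].
  apply: cvg_at_left_filter; apply: cvgB; last exact: continuous_horner.
  by apply: cvg_norm; exact: continuous_horner.
apply: (cvgr_to_le cF); near=> r.
have r0 : 0 < r by near: r; exact: nbhs_left_gt.
have r1 : r < 1 by near: r; exact: nbhs_left_lt.
have r10 : 0 < 1 - r by rewrite subr_gt0.
rewrite subr_le0 -(ler_pM2l r10) -[X in X * `|_|](gtr0_norm r10) -normrM.
have := H r r0 r1; rewrite (SE a) (SE b).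
have -> : (1 - r) * (S a).[r] * I - (1 - r) * (S b).[r] * L = (1 - r) * P.[r].
  by rewrite !hornerE; ring.
suff -> : (1 - r ^+ e) * ((1 - r) * (S b).[r]) * N = (1 - r) * Q.[r] by [].
by rewrite hornerZ hornerM hornerD hornerN hornerXn hornerC; ring.
Unshelve. all: by end_near. Qed.

(** This is Euler's identity integrated over G: the divergence theorem applied
to the field (1 - g) p x, which vanishes on the boundary of G, would give it
too. *)
Lemma moment_homogeneous (R : realType) n d m (g p : mpoly n R) :
  homogeneous d g -> compact (sublevel1 g) -> homogeneous m p ->
  (n + m + d)%:R * \int[lebesgue_rV n]_(x in sublevel1 g) meval (x ord0) (p * g)
  = (n + m)%:R * \int[lebesgue_rV n]_(x in sublevel1 g) meval (x ord0) p.
Proof.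
move=> gh Gc ph; apply: squeeze_at1 => r r0 r1.
exact: (sublevel_shell_estimate gh Gc ph r0 (ltW r1)).
Qed.

(** * Definiteness of the integral of squares *)

(** If h is nonzero at some point, homogeneity moves that point to one where
moreover g < 1, and continuity gives a box of positive volume around it that
lies in G and on which h^2 stays above a positive constant. *)
Lemma square_integral_eq0 (R : realType) n d m (g h : mpoly n R) :
  (0 < d)%N -> homogeneous d g -> compact (sublevel1 g) -> homogeneous m h ->
  \int[lebesgue_rV n]_(x in sublevel1 g) meval (x ord0) (h * h) = 0 ->
  forall x : 'rV[R]_n, meval (x ord0) h = 0.
Proof.
move=> d0 gh Gc hh int0 x0; apply/eqP; apply: contraTT isT => hx0.
have [y0 gy0 hy0] : exists2 y : 'rV[R]_n,
    meval (y ord0) g < 1 & meval (y ord0) h != 0.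
  (* As t <= 1 and d > 0, g (t x0) = t^d g(x0) <= t |g(x0)| < 1. *)
  pose t := (1 + `|meval (x0 ord0) g|)^-1.
  have t0 : 0 < t by rewrite invr_gt0 ltr_wpDr.
  exists (t *: x0);
    rewrite (homogeneousE _ _ gh, homogeneousE _ _ hh); last first.
    by rewrite mulf_neq0// expf_neq0// gt_eqF.
  have t1 : t <= 1 by rewrite invf_le1 ?ltr_wpDr// lerDl.
  apply: (@le_lt_trans _ _ (t * `|meval (x0 ord0) g|)).
    rewrite (le_trans (ler_norm _))// normrM ger0_norm ?exprn_ge0 ?(ltW t0)//.
    apply: ler_wpM2r => //; rewrite -[leRHS]expr1.
    by apply: ler_wiXn2l => //; exact: ltW.
  by rewrite /t mulrC ltr_pdivrMr ?ltr_wpDr// mul1r ltrDr.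
pose c := meval (y0 ord0) (h * h) / 2.
have hhy0 : 0 < meval (y0 ord0) (h * h).
  by rewrite mevalM -expr2 exprn_even_gt0.
have c0 : 0 < c by rewrite divr_gt0.
have [e e0 Be] : exists2 e, 0 < e & forall y, ball y0 e y ->
    meval (y ord0) g < 1 /\ c < meval (y ord0) (h * h).
  have : nbhs y0 [set y : 'rV[R]_n |
      meval (y ord0) g < 1 /\ c < meval (y ord0) (h * h)].
    near=> y; split; near: y.
      by apply: (cvgr_lt _ (@continuous_meval R n g y0)).
    apply: (cvgr_gt _ (@continuous_meval R n (h * h) y0)).
    by rewrite /c ltr_pdivrMr// mulr_natr mulr2n ltrDl.
  by move=> /nbhs_ballP[e /= e0 He]; exists e => // y /He.
(* Balls of row vectors are boxes, whose volume is known. *)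
pose B := [set x : 'rV[R]_n | forall i, ball (y0 ord0 i) e (x ord0 i)].
have BP y : B y -> meval (y ord0) g < 1 /\ c < meval (y ord0) (h * h).
  by move=> By; apply: Be; split => // i j; rewrite ord1.
have mb (i : 'I_n) : measurable (ball (y0 ord0 i) e) by exact: measurable_ball.
have mB : measurable B := measurable_box mb.
have muB : lebesgue_rV n B = ((e *+ 2) ^+ n)%:E.
  rewrite /B (lebesgue_rV_prod mb).
  under eq_bigr do rewrite lebesgue_measure_ball ?ltW//.
  by rewrite -(big_morph EFin (@EFinM R) erefl) prodr_const card_ord.
have mG : measurable (sublevel1 g) by exact: measurable_sublevel.
have BG : B `<=` sublevel1 g by move=> y /BP[/ltW].
have intG := meval_integrable (h * h) Gc mG.
have := int0; rewrite -(setDUK BG) Rintegral_setU//; last 3 first.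
- exact: measurableD.
- by rewrite setDUK.
- by apply/disj_set2P; rewrite setDIK.
suff : 0 < \int[lebesgue_rV n]_(x in B) meval (x ord0) (h * h).
  have : 0 <= \int[lebesgue_rV n]_(x in sublevel1 g `\` B)
      meval (x ord0) (h * h).
    by apply: Rintegral_ge0 => x _; rewrite mevalM -expr2 sqr_ge0.
  move=> nonneg pos /eqP; rewrite paddr_eq0 ?(ltW pos)//.
  by rewrite gt_eqF.
apply: (@lt_le_trans _ _ (\int[lebesgue_rV n]_(x in B) c)).
  rewrite Rintegral_cst// [X in fine X]muB mulr_gt0//= exprn_gt0//.
  by rewrite pmulrn_rgt0.
apply: le_Rintegral => //.
- apply: integrableS BG _ => //.
  rewrite (_ : EFin \o _ =
      EFin \o (fun x : 'rV[R]_n => meval (x ord0) (mpolyC n c))).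
    exact: meval_integrable.
  by apply/funext => x /=; rewrite mevalC.
- exact: integrableS intG.
- by move=> x /BP[_ /ltW].
Unshelve. all: by end_near. Qed.

(** * Forms and their coefficient vectors *)

Lemma horner_eq0 (R : numDomainType) (p : {poly R}) :
  (forall t, p.[t] = 0) -> p = 0.
Proof.
move=> p0; apply: (@roots_geq_poly_eq0 _ _ [seq i%:R | i <- iota 0 (size p)]).
- by apply/allP => t _; rewrite /root p0.
- by rewrite map_inj_uniq ?iota_uniq// => i j /eqP; rewrite eqr_nat => /eqP.
- by rewrite size_map size_iota.
Qed.

Lemma base_expansion_inj B n (a b : 'I_n -> nat) :
  (forall i, a i < B)%N -> (forall i, b i < B)%N ->
  (\sum_(i < n) a i * B ^ i = \sum_(i < n) b i * B ^ i)%N -> a =1 b.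
Proof.
elim: n a b => [|n IH] a b aB bB; first by move=> _ [].
have B0 : (0 < B)%N by apply: leq_ltn_trans (aB ord0).
rewrite !big_ord_recl !muln1.
have shift (f : 'I_n.+1 -> nat) :
    (\sum_(i < n) f (lift ord0 i) * B ^ lift ord0 i =
     (\sum_(i < n) f (lift ord0 i) * B ^ i) * B)%N.
  rewrite big_distrl; apply: eq_bigr => i _.
  by rewrite lift0 expnS mulnCA mulnC.
rewrite !shift => E.
have E0 : a ord0 = b ord0.
  have := congr1 (modn^~ B) E.
  by rewrite ![(_ + _ * B)%N]addnC !modnMDl !modn_small.
have ES : (fun i => a (lift ord0 i)) =1 (fun i => b (lift ord0 i)).
  apply: IH => //.
  by move/eqP: E; rewrite E0 eqn_add2l eqn_pmul2r// => /eqP.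
by move=> i; have [j ->|->] := unliftP ord0 i.
Qed.

Section exponents.
Context (n d : nat).

Lemma mdeg_exponent (i : 'I_#|exponents n d|) : mdeg (exponent i) = d.
Proof. exact/eqP/(valP (enum_val i)). Qed.

Lemma exponent_inj : injective (@exponent n d).
Proof. by move=> i j /val_inj/val_inj/enum_val_inj. Qed.

Lemma exponent_surj (m : multinom n) : mdeg m = d ->
  exists i : 'I_#|exponents n d|, exponent i = m.
Proof.
move=> md.
have mb : (mdeg m < d.+1)%N by rewrite md.
have ed : mdeg (BMultinom mb) == d by apply/eqP.
exists (enum_rank (Sub (BMultinom mb) ed : exponents n d)).
by rewrite /exponent enum_rankK.
Qed.

End exponents.

Definition exponent_poly (R : realType) n d (c : 'I_#|exponents n d| -> R) :
  mpoly n R := \sum_i c i *: mpolyX R (exponent i).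

Lemma meval_exponent_poly (R : realType) n d (c : 'I_#|exponents n d| -> R) x :
  meval x (exponent_poly c) = \sum_i c i * meval x (mpolyX R (exponent i)).
Proof.
by rewrite /exponent_poly raddf_sum; apply: eq_bigr => i _; rewrite /= mevalZ.
Qed.

Lemma mevalX_scale (R : realType) n (m : multinom n) t (x : 'rV[R]_n) :
  meval ((t *: x) ord0) (mpolyX R m) =
  t ^+ mdeg m * meval (x ord0) (mpolyX R m).
Proof.
rewrite !mevalX mdegE -prodrXr -big_split; apply: eq_bigr => i _ /=.
by rewrite mxE exprMn.
Qed.

Lemma exponent_poly_homogeneous (R : realType) n d
    (c : 'I_#|exponents n d| -> R) :
  homogeneous d (exponent_poly c).
Proof.
move=> t x; rewrite !meval_exponent_poly mulr_sumr; apply: eq_bigr => i _.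
by rewrite mevalX_scale mdeg_exponent mulrCA.
Qed.

(** Kronecker substitution: along the curve with coordinates
x_l = t^((d + 1)^l) the monomials of degree d become distinct powers of t,
because their exponents are at most d and hence are digits in base d + 1. *)
Lemma exponent_poly_eq0 (R : realType) n d (c : 'I_#|exponents n d| -> R) :
  (forall x : 'rV[R]_n, meval (x ord0) (exponent_poly c) = 0) ->
  forall i, c i = 0.
Proof.
move=> c0 i.
pose k (j : 'I_#|exponents n d|) := (\sum_(l < n) exponent j l * d.+1 ^ l)%N.
have k_inj : injective k.
  move=> j j' kk; apply: exponent_inj; apply/mnmP.
  have lt (j0 : 'I_#|exponents n d|) l : (exponent j0 l < d.+1)%N.
    by rewrite ltnS -[leqRHS](mdeg_exponent j0) mdegE (bigD1 l)//= leq_addr.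
  exact: base_expansion_inj (lt j) (lt j') kk.
pose p : {poly R} := \sum_j c j *: 'X^(k j).
have p0 : p = 0.
  apply: horner_eq0 => t.
  rewrite -(c0 (\row_l t ^+ (d.+1 ^ l))) meval_exponent_poly horner_sum.
  apply: eq_bigr => j _; rewrite hornerZ hornerXn mevalX; congr (_ * _).
  rewrite /k -prodrXr; apply: eq_bigr => l _.
  by rewrite mxE -exprM mulnC.
have := congr1 (coefp (k i)) p0; rewrite /= coef0 coef_sum (bigD1 i)//=.
rewrite coefZ coefXn eqxx mulr1 big1 ?addr0// => j ji.
by rewrite coefZ coefXn (inj_eq k_inj) eq_sym (negPf ji) mulr0.
Qed.

(** Homogeneity is a property of values here, so that g might a priori have
terms of other degrees.  For fixed x, both g (t x) and t^d g(x) are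
polynomials in t; their coefficients of t^d are the two sides. *)
Lemma homogeneous_exponent_poly (R : realType) n d (g : mpoly n R)
    (x : 'rV[R]_n) :
  homogeneous d g ->
  meval (x ord0) g = meval (x ord0)
    (exponent_poly (fun i : 'I_#|exponents n d| => mcoeff (exponent i) g)).
Proof.
move=> gh.
pose F m := mcoeff m g * meval (x ord0) (mpolyX R m).
pose q : {poly R} := \sum_(m <- msupp g) F m *: 'X^(mdeg m).
have qE : q = meval (x ord0) g *: 'X^d.
  apply/eqP; rewrite -subr_eq0; apply/eqP/horner_eq0 => t.
  rewrite hornerD hornerN hornerZ hornerXn [_ * t ^+ d]mulrC.
  rewrite -(homogeneousE t x gh).
  apply/eqP; rewrite subr_eq0; apply/eqP.
  rewrite mevalE horner_sum; apply: eq_bigr => m _.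
  rewrite hornerZ hornerXn /F -mulrA; congr (_ * _).
  by rewrite mulrC -mevalX_scale mevalX.
have := congr1 (coefp d) qE; rewrite /= coefZ coefXn eqxx mulr1 => <-.
rewrite /q coef_sum meval_exponent_poly.
under eq_bigr do rewrite coefZ coefXn eq_sym mulr_natr mulrb.
rewrite -big_mkcond /=.
transitivity (\sum_(m <- [seq exponent i | i : 'I_#|exponents n d|]) F m);
  last by rewrite big_map big_enum.
(* Monomials of degree d outside the support of g contribute 0. *)
rewrite [RHS](bigID (fun m => m \in msupp g)) /= [X in _ + X]big1 ?addr0;
  last by move=> m /memN_msupp_eq0 gm0; rewrite /F gm0 mul0r.
rewrite -[LHS]big_filter -[RHS]big_filter; apply: perm_big; apply: uniq_perm.
- exact/filter_uniq/msupp_uniq.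
- by apply: filter_uniq; rewrite map_inj_uniq ?enum_uniq//; exact: exponent_inj.
move=> m; rewrite !mem_filter andbC; congr (_ && _).
apply/eqP/mapP => [/exponent_surj[i <-]|[i _ ->]]; last exact: mdeg_exponent.
by exists i => //; rewrite mem_enum.
Qed.

(** * The moment matrix as a bilinear form *)

Section moment_form.
Context (R : realType) (n d : nat) (G : set 'rV[R]_n).
Context (G_compact : compact G) (mG : measurable G).

Lemma Rintegral_meval_sum (I : Type) (s : seq I) (c : I -> R)
    (p : I -> mpoly n R) :
  \int[lebesgue_rV n]_(x in G) meval (x ord0) (\sum_(i <- s) c i *: p i) =
  \sum_(i <- s) c i * \int[lebesgue_rV n]_(x in G) meval (x ord0) (p i).
Proof.
elim: s => [|i s IH].
  rewrite !big_nil; under eq_Rintegral do rewrite meval0.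
  by rewrite Rintegral_cst// mul0r.
rewrite !big_cons -IH -RintegralZl//; last exact: meval_integrable.
rewrite -RintegralD//; last 2 first.
- rewrite (_ : EFin \o _ =
      EFin \o (fun x : 'rV[R]_n => meval (x ord0) (c i *: p i))).
    exact: meval_integrable.
  by apply/funext => x /=; rewrite mevalZ.
- exact: meval_integrable.
by apply: eq_Rintegral => x _; rewrite mevalD mevalZ.
Qed.

Lemma momentE m :
  moment G m = \int[lebesgue_rV n]_(x in G) meval (x ord0) (mpolyX R m).
Proof. by apply: eq_Rintegral => x _; rewrite mevalX. Qed.

Lemma moment_mx_mul (c : 'cV[R]_#|exponents n d|) i :
  (moment_mx d (moment G) *m c) i ord0 =
  \int[lebesgue_rV n]_(x in G) meval (x ord0)
    (mpolyX R (exponent i) * exponent_poly (fun j => c j ord0)).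
Proof.
rewrite mxE /exponent_poly mulr_sumr.
under [in RHS]eq_Rintegral do under eq_bigr do rewrite -scalerAr -mpolyXD.
rewrite Rintegral_meval_sum; apply: eq_bigr => j _.
by rewrite mxE momentE mulrC.
Qed.

Lemma moment_mx_form (c : 'cV[R]_#|exponents n d|) :
  (c^T *m (moment_mx d (moment G) *m c)) ord0 ord0 =
  \int[lebesgue_rV n]_(x in G) meval (x ord0)
    (exponent_poly (fun j => c j ord0) * exponent_poly (fun j => c j ord0)).
Proof.
rewrite mxE; under eq_bigr do rewrite mxE moment_mx_mul.
rewrite -Rintegral_meval_sum {2}/exponent_poly mulr_suml.
by under [in RHS]eq_Rintegral do under eq_bigr do rewrite -scalerAl.
Qed.

End moment_form.

Theorem theorem2 (R : realType) (n d : nat) (g : mpoly n R)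
    (n_ge1 : (1 <= n)%N) (d_ge1 : (1 <= d)%N)
    (g_homog : homogeneous d g) (G_compact : compact (sublevel1 g)) :
  let lambda : multinom n -> R := moment (sublevel1 g) in
  moment_mx d lambda \in unitmx /\
  coef_vec d g = ((n + d)%N%:R / (n + 2 * d)%N%:R) *:
    (invmx (moment_mx d lambda) *m moment_vec d lambda).
Proof.
move=> lambda.
have mG : measurable (sublevel1 g) by exact: measurable_sublevel.
have Munit : moment_mx d lambda \in unitmx.
  rewrite -unitmx_tr -row_free_unit; apply: inj_row_free => u uM0.
  have Mu0 : moment_mx d lambda *m u^T = 0.
    by apply: trmx_inj; rewrite trmx_mul trmxK uM0 trmx0.
  pose h := exponent_poly (fun j => u^T j ord0).
  have h0 : forall x : 'rV[R]_n, meval (x ord0) h = 0.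
    have hh := exponent_poly_homogeneous (fun j => u^T j ord0).
    apply: (square_integral_eq0 d_ge1 g_homog G_compact hh).
    by rewrite -(moment_mx_form G_compact mG) Mu0 mulmx0 mxE.
  by apply/rowP => j; have := exponent_poly_eq0 h0 j; rewrite !mxE.
split=> //.
have MgE : moment_mx d lambda *m coef_vec d g =
    ((n + d)%N%:R / (n + 2 * d)%N%:R) *: moment_vec d lambda.
  apply/colP => i; rewrite (moment_mx_mul G_compact mG).
  rewrite [RHS]mxE [_ i _]mxE /lambda momentE.
  have Xh : homogeneous d (mpolyX R (exponent i)).
    by move=> t x; rewrite mevalX_scale mdeg_exponent.
  under eq_Rintegral => x _.
    rewrite mevalM (_ : meval _ (exponent_poly _) = meval (x ord0) g);
      last first.
      rewrite (homogeneous_exponent_poly _ g_homog) !meval_exponent_poly.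
      by apply: eq_bigr => j _; rewrite mxE.
    rewrite -mevalM; over.
  rewrite mulrAC -(moment_homogeneous g_homog G_compact Xh) -addnA addnn -mul2n.
  by rewrite mulrAC mulfV ?mul1r// pnatr_eq0 addn_eq0 negb_and -lt0n n_ge1.
by rewrite scalemxAr -MgE mulKmx.
Qed.
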